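(* Let $\mathbf{z}\in K_{\exp}^*$ with $z_x=z_z=0$ and $z_y>0$, so that $\{\mathbf{z}\}^\perp\cap K_{\exp}=\mathcal{F}_{-\infty}$ is the two-dimensional face of $K_{\exp}$. Let $\eta>0$ and let $$\gamma_{\mathbf{z},\eta}:=\inf_{\mathbf{v}}\left\{\frac{\mathfrak{g}_{-\infty}(\|\mathbf{w}-\mathbf{v}\|)}{\|\mathbf{w}-\mathbf{u}\|}\;\Big|\;\mathbf{v}\in\partial K_{\exp}\cap B(\eta)\setminus\mathcal{F}_{-\infty},\ \mathbf{w}=P_{\{\mathbf{z}\}^\perp}\mathbf{v},\ \mathbf{u}=P_{\mathcal{F}_{-\infty}}\mathbf{w},\ \mathbf{w}\ne\mathbf{u}\right\}.$$ Then $\gamma_{\mathbf{z},\eta}\in(0,\infty]$ and $$\mathrm{d}(\mathbf{q},\mathcal{F}_{-\infty})\le\max\{2,2\gamma_{\mathbf{z},\eta}^{-1}\}\cdot\mathfrak{g}_{-\infty}(\mathrm{d}(\mathbf{q},K_{\exp}))\quad\text{whenever } \mathbf{q}\in\{\mathbf{z}\}^\perp\cap B(\eta).$$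
   Context: $\mathbb{R}^3$ carries the standard inner product and Euclidean norm; vectors are written $\mathbf{p}=(p_x,p_y,p_z)$. $K_{\exp}=\{(x,y,z):y>0,\ z\ge ye^{x/y}\}\cup\{(x,y,z):x\le0,\ z\ge0,\ y=0\}$ is the exponential cone, $K_{\exp}^*$ its dual cone, $\partial K_{\exp}$ its boundary, and $\mathcal{F}_{-\infty}=\{(x,y,z):x\le0,\ z\ge0,\ y=0\}$. $\mathfrak{g}_{-\infty}:[0,\infty)\to[0,\infty)$ is defined by $\mathfrak{g}_{-\infty}(0)=0$, $\mathfrak{g}_{-\infty}(t)=-t\ln t$ for $0<t\le 1/e^2$, and $\mathfrak{g}_{-\infty}(t)=t+1/e^2$ for $t>1/e^2$. $B(\eta)$ is the closed ball of radius $\eta$ centered at the origin, $\mathrm{d}(\cdot,C)$ is the distance to $C$, $P_C$ the orthogonal projection onto the closed convex set $C$. Conventions: infimum over the empty set is $+\infty$ and $1/\infty=0$. *)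

(* Defs.v *)
From mathcomp Require Import all_boot all_order all_algebra.
From mathcomp Require Import all_classical all_reals all_analysis.

Set Implicit Arguments.
Unset Strict Implicit.
Unset Printing Implicit Defensive.

Import Order.TTheory GRing.Theory Num.Theory.
Import numFieldNormedType.Exports.

Local Open Scope classical_set_scope.
Local Open Scope ring_scope.

Section EuclideanSpace.
Context {R : realType}.
Implicit Types (u v w x z : 'rV[R]_3) (C : set 'rV[R]_3).

Definition vx v : R := v 0 0.
Definition vy v : R := v 0 1.
Definition vz v : R := v 0 2.

Definition dot u v : R := (u *m v^T) 0 0.

(* The library norm on ['rV[R]_3] is the sup norm (it induces the same
   topology, hence the same closure and interior). *)
Definition enorm v : R := Num.sqrt (dot v v).

Definition cball (eta : R) : set 'rV[R]_3 := [set v | enorm v <= eta].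

Definition dist v C : R := inf [set enorm (v - c) | c in C].

(* [is_proj C v w] states that w = P_C v; for a nonempty closed convex C such
   a nearest point exists and is unique. *)
Definition is_proj C v w : Prop :=
  C w /\ forall c, C c -> enorm (v - w) <= enorm (v - c).

Definition orth z : set 'rV[R]_3 := [set x | dot z x = 0].

Definition dual_cone C : set 'rV[R]_3 :=
  [set z | forall x, C x -> 0 <= dot z x].

Definition boundary C : set 'rV[R]_3 := closure C `\` interior C.

End EuclideanSpace.

Section ExponentialCone.
Variable R : realType.

Definition F_ninfty : set 'rV[R]_3 :=
  [set v | [/\ vx v <= 0, 0 <= vz v & vy v = 0]].

Definition K_exp : set 'rV[R]_3 :=
  [set v | 0 < vy v /\ vy v * expR (vx v / vy v) <= vz v] `|` F_ninfty.

(* Only meaningful, and only used, for 0 <= t. *)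
Definition g_ninfty (t : R) : R :=
  if t == 0 then 0
  else if t <= (expR 1 ^+ 2)^-1 then - t * ln t
  else t + (expR 1 ^+ 2)^-1.

Definition gamma (z : 'rV[R]_3) (eta : R) : \bar R :=
  ereal_inf [set r : \bar R | exists v w u : 'rV[R]_3,
    [/\ (boundary K_exp `&` cball eta `\` F_ninfty) v,
        is_proj (orth z) v w,
        is_proj F_ninfty w u,
        w <> u
      & r = (g_ninfty (enorm (w - v)) / enorm (w - u))%:E]].

End ExponentialCone.

Arguments F_ninfty {R}.
Arguments K_exp {R}.

(* Main.v *)
(* Let g be the gauge, K the cone, F the face. Off F, a point v of K with
   |v| <= eta satisfies v_x <= v_y ln (eta / v_y), which is at most a constant
   times g(v_y); as v_y = |w - v| and v_x = |w - u|, this gives gamma > 0.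
   For the error bound take v = P_K q, w = P_{z^perp} v and u = P_F w, so that
   d(q, F) <= |q - w| + |w - u| with |q - w| <= |q - v|. If
   |w - u| <= |q - v|, the bound 2 d(q, K) <= 2 g(d(q, K)) follows; otherwise
   v is admissible in the infimum defining gamma, and
   |w - u| <= g(|w - v|) / gamma <= g(d(q, K)) / gamma by monotonicity of g. *)
Require Import Defs.
From mathcomp Require Import all_boot all_order all_algebra.
From mathcomp Require Import all_classical all_reals all_analysis.
From mathcomp Require Import ring lra.

Set Implicit Arguments.
Unset Strict Implicit.
Unset Printing Implicit Defensive.

Import Order.TTheory GRing.Theory Num.Theory.
Import numFieldNormedType.Exports.

Local Open Scope classical_set_scope.
Local Open Scope ring_scope.

(** * Euclidean geometry of three-space in coordinates *)

Section Coordinates.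
Context {R : realType}.
Implicit Types (u v w : 'rV[R]_3) (a x y t : R).

Definition vec3 x y t : 'rV[R]_3 := \row_i [:: x; y; t]`_i.

Lemma vx_vec3 x y t : vx (vec3 x y t) = x. Proof. by rewrite /vx mxE. Qed.
Lemma vy_vec3 x y t : vy (vec3 x y t) = y. Proof. by rewrite /vy mxE. Qed.
Lemma vz_vec3 x y t : vz (vec3 x y t) = t. Proof. by rewrite /vz mxE. Qed.

Lemma forall_ord3 (P : 'I_3 -> Prop) : P 0 -> P 1 -> P 2 -> forall i, P i.
Proof.
move=> P0 P1 P2 [[|[|[|//]]] hi].
- by rewrite (_ : Ordinal hi = 0) //; apply: val_inj.
- by rewrite (_ : Ordinal hi = 1) //; apply: val_inj.
- by rewrite (_ : Ordinal hi = 2) //; apply: val_inj.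
Qed.

Lemma vec3_0 : vec3 0 0 0 = 0.
Proof. by apply/rowP; apply: forall_ord3; rewrite !mxE. Qed.

Lemma coords_inj u v : vx u = vx v -> vy u = vy v -> vz u = vz v -> u = v.
Proof. by move=> *; apply/rowP; apply: forall_ord3. Qed.

Lemma vxB u v : vx (u - v) = vx u - vx v. Proof. by rewrite /vx !mxE. Qed.
Lemma vyB u v : vy (u - v) = vy u - vy v. Proof. by rewrite /vy !mxE. Qed.
Lemma vzB u v : vz (u - v) = vz u - vz v. Proof. by rewrite /vz !mxE. Qed.
Lemma vxD u v : vx (u + v) = vx u + vx v. Proof. by rewrite /vx !mxE. Qed.
Lemma vyD u v : vy (u + v) = vy u + vy v. Proof. by rewrite /vy !mxE. Qed.
Lemma vzD u v : vz (u + v) = vz u + vz v. Proof. by rewrite /vz !mxE. Qed.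
Lemma vxZ a v : vx (a *: v) = a * vx v. Proof. by rewrite /vx !mxE. Qed.
Lemma vyZ a v : vy (a *: v) = a * vy v. Proof. by rewrite /vy !mxE. Qed.
Lemma vzZ a v : vz (a *: v) = a * vz v. Proof. by rewrite /vz !mxE. Qed.

Definition coordE := (vxB, vyB, vzB, vxD, vyD, vzD, vxZ, vyZ, vzZ,
  vx_vec3, vy_vec3, vz_vec3).

Lemma dotE u v : dot u v = vx u * vx v + vy u * vy v + vz u * vz v.
Proof.
rewrite /dot mxE !big_ord_recl big_ord0 addr0 !mxE addrA.
have -> : lift ord0 ord0 = 1 :> 'I_3 by apply: val_inj.
by have -> : lift ord0 (lift ord0 ord0) = 2 :> 'I_3 by apply: val_inj.
Qed.

Lemma dot_ge0 u : 0 <= dot u u.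
Proof. by rewrite dotE -!expr2 !addr_ge0 ?sqr_ge0. Qed.

Lemma dot_gt0 u : u != 0 -> 0 < dot u u.
Proof.
apply: contraNT; rewrite -leNgt dotE => h; apply/eqP.
by rewrite -vec3_0; apply: coords_inj; rewrite coordE; nra.
Qed.

Lemma enorm_ge0 u : 0 <= enorm u.
Proof. exact: sqrtr_ge0. Qed.

Lemma enorm0 : enorm (0 : 'rV[R]_3) = 0.
Proof. by rewrite /enorm dotE -vec3_0 !coordE !mulr0 !addr0 sqrtr0. Qed.

Lemma enorm_sqr u : enorm u ^+ 2 = dot u u.
Proof. by rewrite sqr_sqrtr ?dot_ge0. Qed.

Lemma enorm_le u v : (enorm u <= enorm v) = (dot u u <= dot v v).
Proof. by rewrite ler_sqrt ?dot_ge0. Qed.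

Lemma enorm_leP u a : 0 <= a -> (enorm u <= a) = (dot u u <= a ^+ 2).
Proof. by move=> a0; rewrite -enorm_sqr ler_sqr ?nnegrE ?enorm_ge0. Qed.

(** Lagrange's identity: the squared product of the norms exceeds the squared inner product by the
    squares of the three 2 by 2 minors. *)
Lemma dot_le_enorm u v : dot u v <= enorm u * enorm v.
Proof.
have h : dot u v ^+ 2 <= (enorm u * enorm v) ^+ 2.
  rewrite exprMn !enorm_sqr !dotE.
  have := sqr_ge0 (vx u * vy v - vy u * vx v).
  have := sqr_ge0 (vx u * vz v - vz u * vx v).
  have := sqr_ge0 (vy u * vz v - vz u * vy v).
  lra.
by rewrite (le_trans (ler_norm _)) // -ler_sqr ?nnegrE ?mulr_ge0 ?enorm_ge0 //
  real_normK ?num_real.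
Qed.

Lemma enormD u v : enorm (u + v) <= enorm u + enorm v.
Proof.
rewrite enorm_leP ?addr_ge0 ?enorm_ge0 // sqrrD !enorm_sqr.
have := dot_le_enorm u v; rewrite !dotE !coordE; lra.
Qed.

Lemma vx_le_enorm u : vx u <= enorm u.
Proof.
rewrite (le_trans (ler_norm _)) // -sqrtr_sqr ler_sqrt ?dot_ge0 //.
by rewrite dotE -!expr2 -addrA lerDl addr_ge0 ?sqr_ge0.
Qed.

Lemma vz_le_enorm u : vz u <= enorm u.
Proof.
rewrite (le_trans (ler_norm _)) // -sqrtr_sqr ler_sqrt ?dot_ge0 //.
by rewrite dotE -!expr2 lerDr addr_ge0 ?sqr_ge0.
Qed.

Lemma coord_sub_continuous v (i : 'I_3) :
  continuous (fun w : 'rV[R]_3 => v 0 i - w 0 i).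
Proof.
move=> w; apply: (@continuousB _ R^o _ (cst (v 0 i)) (fun w : 'rV[R]_3 => w 0 i)).
- exact: cst_continuous.
- exact: coord_continuous.
Qed.

Lemma dot_sub_continuous v : continuous (fun w => dot (v - w) (v - w)).
Proof.
move=> w; under eq_fun do rewrite dotE !coordE.
have c i := continuousM (@coord_sub_continuous v i w) (@coord_sub_continuous v i w).
exact: (@continuousD _ R^o _ _ _ _ (@continuousD _ R^o _ _ _ _ (c 0) (c 1)) (c 2)).
Qed.

(** * Distances and nearest points *)

Lemma dist_le (C : set 'rV[R]_3) v c : C c -> dist v C <= enorm (v - c).
Proof.
move=> Cc; apply: ge_inf; last by exists c.
by exists 0 => _ [d _ <-]; exact: enorm_ge0.
Qed.

Lemma dist_ge0 (C : set 'rV[R]_3) v : C !=set0 -> 0 <= dist v C.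
Proof.
move=> [c Cc]; apply: lb_le_inf; first by exists (enorm (v - c)), c.
by move=> _ [d _ <-]; exact: enorm_ge0.
Qed.

Lemma dist_proj (C : set 'rV[R]_3) v w : is_proj C v w -> dist v C = enorm (v - w).
Proof.
move=> [Cw hw]; apply/eqP; rewrite eq_le dist_le //=.
by apply: lb_le_inf => [|_ [c Cc <-]]; [exists (enorm (v - w)), w | exact: hw].
Qed.

(** The squared distance attains its minimum on the part of [C] in a compact box around [v]; the box
    holds every point at least as close to [v] as a chosen [c0]. *)
Lemma proj_exists (C : set 'rV[R]_3) v :
  closed C -> C !=set0 -> exists w, is_proj C v w.
Proof.
move=> Ccl [c0 Cc0].
(* With the added 1, [2 * t <= t ^+ 2 + 1] turns a bound [M - 1] on a squared coordinate difference
   into a bound [M] on its absolute value. *)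
pose M := 1 + dot (v - c0) (v - c0).
have cbox : compact [set c : 'rV[R]_3 |
    forall i : 'I_3, `[v ord0 i - M, v ord0 i + M]%classic (c ord0 i)].
  by apply: (@rV_compact _ _ (fun i => `[v ord0 i - M, v ord0 i + M]%classic)) => i;
     exact: segment_compact.
have M1 : 1 <= M by rewrite /M lerDl dot_ge0.
have inbox c : dot (v - c) (v - c) <= dot (v - c0) (v - c0) ->
    forall i : 'I_3, `[v ord0 i - M, v ord0 i + M]%classic (c ord0 i).
  rewrite [X in _ <= X -> _](_ : _ = M - 1); last by rewrite /M; ring.
  rewrite dotE !coordE => h.
  have ineq a b : (a - b) * (a - b) <= M - 1 -> a - M <= b <= a + M.
    have := sqr_ge0 (a - b - 1); have := sqr_ge0 (a - b + 1).
    by move=> ? ? ?; apply/andP; split; lra.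
  have := sqr_ge0 (vx v - vx c); have := sqr_ge0 (vy v - vy c).
  have := sqr_ge0 (vz v - vz c) => ? ? ?.
  by apply: forall_ord3; rewrite /= in_itv /=; apply: ineq;
     rewrite -/(vx v) -/(vx c) -/(vy v) -/(vy c) -/(vz v) -/(vz c); lra.
have [||w] := @EVT_min_rV R 3 (fun c => dot (v - c) (v - c)) _ _
    (compact_closedI cbox Ccl).
- by exists c0; split => //; exact: inbox.
- by apply: continuous_subspaceT; exact: dot_sub_continuous.
rewrite inE => -[_ Cw] hw; exists w; split=> // c Cc; rewrite enorm_le.
have [hc|hc] := leP (dot (v - c) (v - c)) (dot (v - c0) (v - c0)).
  by apply: hw; rewrite inE; split => //; exact: inbox.
apply: le_trans (ltW hc); apply: hw; rewrite inE; split => //; exact: inbox.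
Qed.

(** If [w] were interior, a short move from [w] towards [v] would stay in [C] and come closer to
    [v]. *)
Lemma proj_boundary (C : set 'rV[R]_3) v w :
  is_proj C v w -> ~ C v -> boundary C w.
Proof.
move=> [Cw hw] nCv; split; first exact: subset_closure.
rewrite /interior /= => /nbhs_ballP[e /= e0 he].
have d0 : v - w != 0.
  by apply/eqP => /eqP; rewrite subr_eq0 => /eqP vw; apply: nCv; rewrite vw.
pose N : R := `|v - w|; have N0 : 0 <= N by exact: normr_ge0.
(* This step length gives [s * N < e] and [0 < s <= 1]; [N] is the sup norm because [ball] is
   measured in it. *)
pose s := e / (e + N).
have eN : 0 < e + N by lra.
have s0 : 0 < s by rewrite divr_gt0.
have s1 : s <= 1 by rewrite ler_pdivrMr // mul1r lerDl.
have /he /hw : ball w e (w + s *: (v - w)).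
  rewrite -ball_normE /ball_ /= opprD addNKr normrN normrZ gtr0_norm // -/N.
  have -> : s * N = e * (N / (e + N)) by rewrite /s mulrAC mulrA.
  by rewrite gtr_pMr // ltr_pdivrMr // mul1r ltrDr.
rewrite enorm_le.
have -> : v - (w + s *: (v - w)) = (1 - s) *: (v - w).
  by rewrite opprD addrA scalerBl scale1r.
have := dot_gt0 d0; move: (v - w) => u; rewrite !dotE !coordE => p0 h.
have : s * (2 - s) * (vx u * vx u + vy u * vy u + vz u * vz u) <= 0 by lra.
by rewrite leNgt mulr_gt0 // mulr_gt0 // subr_gt0; lra.
Qed.

(** Shrinking [w] inside the cone cannot improve the distance, so [dot (v - w) w >= 0]; expanding
    [v = (v - w) + w] then gives the bound. *)
Lemma proj_cone_enorm (C : set 'rV[R]_3) v w :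
  (forall a c, 0 <= a -> C c -> C (a *: c)) -> is_proj C v w -> enorm w <= enorm v.
Proof.
move=> Ccone [Cw hw]; rewrite enorm_le.
suff h : 0 <= dot (v - w) w.
  have := dot_ge0 (v - w); move: h; rewrite !dotE !coordE; lra.
rewrite leNgt; apply/negP => h.
have w0 : 0 < dot w w.
  apply: dot_gt0; apply/eqP => w0; move: h; rewrite w0 dotE.
  by rewrite -vec3_0 !coordE !mulr0 !addr0 ltxx.
set a := dot (v - w) w in h; set b := dot w w in w0.
have key s : 0 <= s <= 1 -> 0 <= s * (2 * a + s * b).
  move=> /andP[s0 s1]; have := hw _ (Ccone (1 - s) w _ Cw); rewrite enorm_le.
  move=> /(_ ltac:(lra)); rewrite /a /b !dotE !coordE; lra.
(* Here [s * b = s * a - a], so [2 * a + s * b = (1 + s) * a < 0], against [key]. *)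
pose s := - a / (b - a).
have ba : 0 < b - a by lra.
have s0 : 0 < s by rewrite divr_gt0 // oppr_gt0.
have s1 : s <= 1 by rewrite ler_pdivrMr // mul1r; lra.
have := key s; rewrite (ltW s0) s1 => /(_ isT); rewrite pmulr_rge0 //.
have : s * (b - a) = - a by rewrite divfK ?gt_eqF.
nra.
Qed.

End Coordinates.

(** * Growth and monotonicity of the gauge *)

Section Gauge.
Variable R : realType.
Implicit Types s t : R.

Local Notation e2 := ((expR 1 ^+ 2)^-1 : R).

Lemma e2_gt0 : 0 < e2. Proof. by rewrite invr_gt0 exprn_gt0 ?expR_gt0. Qed.

Lemma ln_e2 : ln e2 = - 2.
Proof. by rewrite -expRM_natl mulr1 -expRN expRK. Qed.

Lemma ln_le_e2 t : 0 < t -> (t <= e2) = (ln t <= - 2).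
Proof. by move=> t0; rewrite -ln_e2 ler_ln ?posrE ?e2_gt0. Qed.

Lemma g_ninfty_ge t : 0 <= t -> t <= g_ninfty t.
Proof.
rewrite le_eqVlt => /predU1P[<-|t0]; first by rewrite /g_ninfty eqxx.
rewrite /g_ninfty gt_eqF //; case: ifPn => [|_]; last by rewrite lerDl ltW ?e2_gt0.
by rewrite ln_le_e2 // => h; nra.
Qed.

(* On [0, 1/e^2] the logarithm is at most -2, so with r = t / s the bound
   [ln r <= r - 1] yields monotonicity of [- t ln t] without differentiating. *)
Lemma g_ninfty_homo s t : 0 <= s -> s <= t -> g_ninfty s <= g_ninfty t.
Proof.
rewrite le_eqVlt => /predU1P[<- t0|s0 st].
  rewrite [g_ninfty 0](_ : _ = 0); last by rewrite /g_ninfty eqxx.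
  exact: le_trans (g_ninfty_ge t0).
have t0 : 0 < t by exact: lt_le_trans s0 st.
have low x y : 0 < x -> x <= y -> y <= e2 -> - x * ln x <= - y * ln y.
  move=> x0 xy; have y0 : 0 < y by exact: lt_le_trans x0 xy.
  rewrite ln_le_e2 // => hy.
  have hl : ln y - ln x <= y / x - 1.
    rewrite -ln_div ?posrE // -[X in ln X](subrK 1) addrC le_ln1Dx //.
    by rewrite ltrBrDr addNr divr_gt0.
  have : x * (ln y - ln x) <= y - x.
    rewrite -(ler_pM2l x0) in hl; apply: le_trans hl _.
    by rewrite mulrBr mulr1 mulrC divfK ?gt_eqF.
  nra.
rewrite /g_ninfty !gt_eqF //; case: ifPn => hs; case: ifPn => ht.
- exact: low.
(* Across the break point, compare through the value at [e2]: it is [2 * e2], which is less than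
   [t + e2]. *)
- have := low _ _ s0 hs (lexx _); rewrite ln_e2 => h.
  by move: ht; rewrite -ltNge => ht; lra.
- by rewrite (le_trans st ht) in hs.
- by rewrite lerD2r.
Qed.

End Gauge.

(** * The exponential cone, its face, and positivity of [gamma] *)

Section ExponentialCone.
Variable R : realType.
Implicit Types (c v w u q : 'rV[R]_3) (a x y t : R).

(* The tangent-line bounds [expR (x / y) >= expR t * (1 + x / y - t)] exhibit
   [K_exp] as an intersection of closed half-spaces. *)
Lemma K_exp_halfspaces : K_exp = [set v : 'rV[R]_3 | 0 <= vy v] `&`
  [set v | 0 <= vz v] `&`
  \bigcap_t [set v | 0 <= vz v - expR t * (vx v + (1 - t) * vy v)].
Proof.
apply/seteqP; split => v.
  case=> [[y0 hz]|[x0 z0 y0]].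
    split; first by split; rewrite /= ?(ltW y0) // (le_trans _ hz) // mulr_ge0 ?expR_ge0 ?ltW.
    move=> t _ /=; rewrite subr_ge0 (le_trans _ hz) //.
    have -> : expR (vx v / vy v) = expR t * expR (vx v / vy v - t).
      by rewrite -expRD addrC subrK.
    rewrite mulrCA ler_pM2l ?expR_gt0 //.
    apply: le_trans (ler_wpM2l (ltW y0) (expR_ge1Dx (vx v / vy v - t))).
    have : vy v * (vx v / vy v) = vx v by rewrite mulrC divfK ?gt_eqF.
    lra.
  split; first by split; rewrite /= ?y0.
  move=> t _ /=; rewrite y0 mulr0 addr0 subr_ge0 (le_trans _ z0) //.
  by rewrite mulr_ge0_le0 ?expR_ge0.
move=> [[/= y0 z0] h]; move: y0; rewrite le_eqVlt => /predU1P[y0|y0]; [right|left].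
  split => //; rewrite leNgt; apply/negP => x0.
  (* For [vy v = 0] and [vx v > 0], this slope makes the half-space inequality read
     [vz v + 1 <= vz v]. *)
  have := h (ln ((vz v + 1) / vx v)) I.
  rewrite /= lnK ?posrE ?divr_gt0 //; last by lra.
  by rewrite -y0 mulr0 addr0 divfK ?gt_eqF //; lra.
(* The tangent taken at [vx v / vy v] itself is exact there. *)
split => //; have := h (vx v / vy v) I; rewrite /= subr_ge0; apply: le_trans.
rewrite [leLHS]mulrC ler_pM2l ?expR_gt0 // mulrBl divfK ?gt_eqF // mul1r.
by rewrite addrC subrK.
Qed.

Lemma K_exp_closed : closed (@K_exp R).
Proof.
have cx : continuous (@vx R) by move=> v; exact: coord_continuous.
have cy : continuous (@vy R) by move=> v; exact: coord_continuous.
have cz : continuous (@vz R) by move=> v; exact: coord_continuous.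
have half (f : 'rV[R]_3 -> R) : continuous f -> closed [set v | 0 <= f v].
  by move=> cf; apply: (@preimage_closed _ _ f [set a | 0 <= a]) => [v _|];
     [exact: cf | exact: closed_ge].
rewrite K_exp_halfspaces; apply: closedI; first by apply: closedI; exact: half.
apply: closed_bigI => t _; apply: half => v.
have cy' : continuous (fun v : 'rV[R]_3 => (1 - t) * vy v).
  by move=> w; exact: (continuousM (@cst_continuous _ _ (1 - t) w) (cy w)).
have cxy : continuous (fun v : 'rV[R]_3 => vx v + (1 - t) * vy v).
  by move=> w; exact: (@continuousD _ R^o _ _ _ _ (cx w) (cy' w)).
apply: (@continuousB _ R^o _ _ _ _ (cz v)).
exact: (continuousM (@cst_continuous _ _ (expR t) v) (cxy v)).
Qed.

(** The half-space inequalities are homogeneous, so [a = 0] needs no separate case. *)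
Lemma K_exp_scale a v : 0 <= a -> K_exp v -> K_exp (a *: v).
Proof.
move=> a0; rewrite K_exp_halfspaces => -[[/= y0 z0] h].
split; first by split; rewrite /= coordE mulr_ge0.
move=> t _ /=; rewrite !coordE; have /= := h t I; move=> ht.
have := mulr_ge0 a0 ht; lra.
Qed.

Lemma orth_y z v : vx z = 0 -> vz z = 0 -> 0 < vy z -> orth z v <-> vy v = 0.
Proof.
move=> hx hz hy; rewrite /orth /= dotE hx hz !mul0r addr0 add0r.
split => [/eqP|->]; last by rewrite mulr0.
by rewrite mulf_eq0 gt_eqF //= => /eqP.
Qed.

(** The face is a product of half-lines in the plane [y = 0], so projecting clamps each coordinate
    separately. *)
Lemma F_ninfty_proj x t : 0 <= t ->
  is_proj F_ninfty (vec3 x 0 t) (vec3 (Num.min x 0) 0 t).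
Proof.
move=> t0; split; first by split; rewrite coordE // ge_min lexx orbT.
move=> c [cx cz cy]; rewrite enorm_le !dotE !coordE cy.
have := sqr_ge0 (t - vz c); have := sqr_ge0 (x - vx c); rewrite !expr2 => sx sz.
case: (leP x 0) => hx; first by lra.
by have := mulr_le0_ge0 cx (ltW hx); nra.
Qed.

Lemma orth_proj_vec3 z v : vx z = 0 -> vz z = 0 -> 0 < vy z ->
  is_proj (orth z) v (vec3 (vx v) 0 (vz v)).
Proof.
move=> hx hz hy; split; first by apply/orth_y; rewrite ?coordE.
move=> c /orth_y -/(_ hx hz hy) cy; rewrite enorm_le !dotE !coordE cy.
by have := sqr_ge0 (vx v - vx c); have := sqr_ge0 (vz v - vz c); lra.
Qed.

(** Minimality against the explicit projection forces the squared differences in [x] and [z] to sum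
    to at most 0. *)
Lemma orth_projE z v w : vx z = 0 -> vz z = 0 -> 0 < vy z ->
  is_proj (orth z) v w -> w = vec3 (vx v) 0 (vz v).
Proof.
move=> hx hz hy [/orth_y -/(_ hx hz hy) wy h].
have [/h] := orth_proj_vec3 v hx hz hy.
rewrite enorm_le !dotE !coordE wy => h1 _.
have := sqr_ge0 (vx v - vx w); have := sqr_ge0 (vz v - vz w) => sz sx.
by apply: coords_inj; rewrite coordE //; apply/esym/eqP;
   rewrite -subr_eq0 -sqrf_eq0; apply/eqP; lra.
Qed.

Lemma enorm_vec3_y y : 0 <= y -> enorm (vec3 0 y 0) = y.
Proof.
by move=> y0; rewrite /enorm dotE !coordE !mul0r addr0 add0r -expr2 sqrtr_sqr ger0_norm.
Qed.

Lemma enorm_orth_proj v : 0 <= vy v -> enorm (vec3 (vx v) 0 (vz v) - v) = vy v.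
Proof.
move=> y0; rewrite -[RHS]enorm_vec3_y // /enorm; congr Num.sqrt.
by rewrite !dotE !coordE; ring.
Qed.

Lemma K_exp_x_le eta v : 0 < eta -> 0 < vy v -> K_exp v -> vz v <= eta ->
  vx v <= vy v * ln eta - vy v * ln (vy v).
Proof.
move=> e0 y0 [[_ hz]|[_ _ y_eq0]] ze; last by rewrite y_eq0 ltxx in y0.
have : ln (expR (vx v / vy v)) <= ln (eta / vy v).
  rewrite ler_ln ?posrE ?expR_gt0 ?divr_gt0 // ler_pdivlMr // mulrC.
  exact: le_trans hz ze.
by rewrite expRK ln_div ?posrE // ler_pdivrMr // mulrBl ![_ * vy v]mulrC.
Qed.

Lemma x_le_g_ninfty eta : 0 < eta -> exists2 c : R, 0 < c &
  forall v, 0 < vy v -> K_exp v -> enorm v <= eta -> vx v <= c * g_ninfty (vy v).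
Proof.
move=> e0; pose e2 := (expR 1 ^+ 2)^-1 : R.
have e2_gt0 : 0 < e2 by exact: e2_gt0.
(* The first two summands serve [vy v <= e2], where [- y * ln y] is the gauge itself; the last
   serves [vy v > e2], where [vx v <= eta < eta / e2 * vy v]. *)
exists (`|ln eta| + 1 + eta / e2) => [|v y0 Kv ve].
  have := normr_ge0 (ln eta); have : 0 < eta / e2 by rewrite divr_gt0.
  lra.
have ez := le_trans (vz_le_enorm v) ve; have ex := le_trans (vx_le_enorm v) ve.
have gy : vy v <= g_ninfty (vy v) by rewrite g_ninfty_ge ?ltW.
have q0 : 0 < eta / e2 by rewrite divr_gt0.
have l0 := normr_ge0 (ln eta).
have [h|h] := leP (vy v) e2.
  have := K_exp_x_le e0 y0 Kv ez => hx; apply: (le_trans hx).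
  have -> : - (vy v * ln (vy v)) = g_ninfty (vy v).
    by rewrite /g_ninfty gt_eqF // -/e2 h mulNr.
  have : vy v * ln eta <= g_ninfty (vy v) * `|ln eta|.
    by apply: le_trans (ler_wpM2r l0 gy); rewrite ler_pM2l // ler_norm.
  have : 0 <= eta / e2 * g_ninfty (vy v) by rewrite mulr_ge0 ?ltW //; lra.
  lra.
have : eta <= eta / e2 * g_ninfty (vy v).
  by rewrite mulrAC ler_pdivlMr // ler_pM2l //; lra.
have : 0 <= (`|ln eta| + 1) * g_ninfty (vy v) by rewrite mulr_ge0 //; lra.
lra.
Qed.

Lemma K_exp_y_gt0 v : K_exp v -> ~ F_ninfty v -> 0 < vy v.
Proof. by case=> [[]|]. Qed.

Lemma orth_K_exp (z : 'rV[R]_3) : vx z = 0 -> vz z = 0 -> 0 < vy z ->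
  orth z `&` K_exp = F_ninfty.
Proof.
move=> hx hz hy; apply/seteqP; split => v.
  by move=> [/orth_y -/(_ hx hz hy) y0 [[]|//]]; rewrite y0 ltxx.
by move=> Fv; split; [apply/orth_y => //; case: Fv | right].
Qed.

Lemma gamma_gt0 (z : 'rV[R]_3) eta : vx z = 0 -> vz z = 0 -> 0 < vy z -> 0 < eta ->
  (0 < gamma z eta)%E.
Proof.
move=> hx hz hy e0; have [c c0 hc] := x_le_g_ninfty e0.
(* The quotients are all at least [c^-1], where [c] bounds [vx v] by the gauge of [vy v]. *)
apply: (@lt_le_trans _ _ (c^-1)%:E); first by rewrite lte_fin invr_gt0.
apply: le_ereal_inf_tmp => _ [v [w [u [[[[cKv _] ev] nFv] pw pu wu ->]]]].
have Kv : K_exp v by rewrite ((closure_id _).1 K_exp_closed).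
have y0 := K_exp_y_gt0 Kv nFv.
rewrite (orth_projE hx hz hy pw) in pu wu *.
have z0 : 0 <= vz v by move: Kv; rewrite K_exp_halfspaces => -[[]].
rewrite (enorm_orth_proj (ltW y0)) lee_fin.
have d0 : 0 < enorm (vec3 (vx v) 0 (vz v) - u).
  by rewrite sqrtr_gt0 dot_gt0 // subr_eq0; apply/eqP.
rewrite ler_pdivlMr // mulrC ler_pdivrMr // mulrC.
(* Comparing [u] with the explicit clamped point bounds the denominator by the positive part of
   [vx v], without identifying [u]. *)
have [F0 _] := F_ninfty_proj (vx v) z0.
apply: le_trans (pu.2 _ F0) _.
have g0 : 0 <= c * g_ninfty (vy v).
  by rewrite mulr_ge0 ?(ltW c0) // (le_trans (ltW y0)) ?g_ninfty_ge ?ltW.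
rewrite enorm_leP // dotE !coordE !subrr !mulr0 !addr0.
have := hc _ y0 Kv ev; case: (leP (vx v) 0) => h; rewrite ?subrr ?mulr0 ?sqr_ge0 // => h1.
by rewrite subr0 -expr2 ler_sqr ?nnegrE // ltW.
Qed.

End ExponentialCone.

(** * The error bound on the hyperplane *)

Theorem theorem4p2 (R : realType) (z : 'rV[R]_3) (eta : R)
    (hz : dual_cone K_exp z) (hzx : vx z = 0) (hzz : vz z = 0)
    (hzy : 0 < vy z) (heta : 0 < eta) :
  [/\ orth z `&` K_exp = F_ninfty,
      (0 < gamma z eta)%E
    & forall q : 'rV[R]_3, (orth z `&` cball eta) q ->
        ((dist q F_ninfty)%:E <=
           maxe 2%:E (2%:E * (gamma z eta)^-1) *
             (g_ninfty (dist q K_exp))%:E)%E].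
Proof.
have gam0 := gamma_gt0 hzx hzz hzy heta.
split => //; first exact: orth_K_exp.
move=> q [/orth_y -/(_ hzx hzz hzy) qy qe].
have F0 : F_ninfty (0 : 'rV[R]_3) by split; rewrite /vx /vy /vz mxE.
have K0 : @K_exp R !=set0 by exists 0; right.
have d0 : 0 <= dist q K_exp by exact: dist_ge0.
have dg := g_ninfty_ge d0.
(* Common exit for [q] in the cone and for small [enorm (w - u)]: the maximum dominates 2, whatever
   [gamma] is. *)
have le2 : dist q F_ninfty <= 2 * g_ninfty (dist q K_exp) ->
    ((dist q F_ninfty)%:E <= maxe 2%:E (2%:E * (gamma z eta)^-1) *
             (g_ninfty (dist q K_exp))%:E)%E.
  rewrite -lee_fin EFinM => /le_trans; apply; apply: lee_wpmul2r.
    by rewrite lee_fin (le_trans d0).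
  by rewrite le_max lexx.
have [Kq|nKq] := pselect (K_exp q).
  apply: le2; have Fq : F_ninfty q.
    by rewrite -(orth_K_exp hzx hzz hzy); split => //; apply/orth_y.
  apply: le_trans (dist_le _ Fq) _; rewrite subrr enorm0; lra.
have [v pv] := proj_exists q (@K_exp_closed R) K0.
have bv := proj_boundary pv nKq.
(* Projection onto a cone does not lengthen, which keeps [v] in the ball as admissibility
   requires. *)
have ve : enorm v <= eta by apply: le_trans qe; apply: proj_cone_enorm pv; exact: K_exp_scale.
have Kv := pv.1; have dE := dist_proj pv.
have [y0 z0] : 0 <= vy v /\ 0 <= vz v.
  by move: Kv; rewrite K_exp_halfspaces => -[[]].
pose w := vec3 (vx v) 0 (vz v); pose u := vec3 (Num.min (vx v) 0) 0 (vz v).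
have pw : is_proj (orth z) v w by exact: orth_proj_vec3.
have pu : is_proj F_ninfty w u by exact: F_ninfty_proj.
(* Both [q] and [w] lie in [y = 0], so Pythagoras splits [q - v] into [q - w] and [w - v]. *)
have qw : enorm (q - w) <= dist q K_exp.
  rewrite dE enorm_le !dotE !coordE qy.
  by have := sqr_ge0 (vy v); lra.
have wv : enorm (w - v) <= dist q K_exp.
  rewrite enorm_orth_proj // dE -[leLHS]enorm_vec3_y //.
  rewrite enorm_le !dotE !coordE qy.
  by have := sqr_ge0 (vx q - vx v); have := sqr_ge0 (vz q - vz v); lra.
have tri : dist q F_ninfty <= enorm (q - w) + enorm (w - u).
  apply: le_trans (dist_le _ pu.1) (le_trans _ (enormD _ _)).
  by rewrite addrA subrK.
have [wu|wu] := leP (enorm (w - u)) (dist q K_exp); first by apply: le2; lra.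
have wu0 : 0 < enorm (w - u) by exact: le_lt_trans wu.
have wnu : w <> u.
  by move=> e; move: wu0; rewrite e subrr enorm0 ltxx.
have nFv : ~ F_ninfty v.
  by move=> [vx0 _ _]; apply: wnu; rewrite /w /u min_l.
have : (gamma z eta <= (g_ninfty (enorm (w - v)) / enorm (w - u))%:E)%E.
  by apply: ereal_inf_lbound; exists v, w, u; split.
(* Admissibility of [v] rules out [+oo] and positivity rules out [-oo], so [gamma] is a real
   [c > 0]. *)
case: (gamma z eta) gam0 le2 => // c; rewrite lte_fin lee_fin => c0 _ cg.
rewrite inver gt_eqF // -EFinM -EFin_max -EFinM lee_fin.
apply: (@le_trans _ _ (2 * c^-1 * g_ninfty (dist q K_exp))); last first.
  by apply: ler_wpM2r; [exact: le_trans dg | rewrite le_max lexx orbT].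
(* In this branch [enorm (q - w) <= dist q K_exp < enorm (w - u)], so [tri] costs only a factor
   2. *)
have : enorm (w - u) <= c^-1 * g_ninfty (dist q K_exp).
  rewrite mulrC ler_pdivlMr // mulrC; rewrite ler_pdivlMr // in cg.
  by apply: le_trans cg _; apply: g_ninfty_homo => //; exact: enorm_ge0.
lra.
Qed.
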